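(* Consider the stochastic energy exchange model $\mathbf{E}_t$ with transition kernel $P^t$ and the function $V=V_\eta$ described in the context. For all sufficiently small $\eta>0$ and $h>0$, there exist constants $c_0>0$ and $M_0>1$, depending on $\eta$, $N$ and $h$, such that $$(P^hV)(\mathbf{E})-V(\mathbf{E})\le -c_0V^{\alpha}(\mathbf{E})$$ for every $\mathbf{E}$ with $V(\mathbf{E})>M_0$, where $\alpha=1-\frac{1}{2(1-\eta)}$.
   Context: Fix an integer $N\ge1$, bath temperatures $T_L,T_R>0$ and a sufficiently large constant $K$ ($K\gg T_L,T_R$). Let $R(a,b)=\min\{K,\sqrt{\min(a,b)}\}$. The stochastic energy exchange model is the Markov jump process $\mathbf{E}_t=(E_1(t),\dots,E_N(t))$ on $\mathbb{R}^N_+$: for each $i=1,\dots,N-1$ an exponential clock with rate $R(E_i,E_{i+1})$ is attached to sites $i,i+1$; when it rings, $(E_i,E_{i+1})$ becomes $(p(E_i+E_{i+1}),(1-p)(E_i+E_{i+1}))$ with $p$ uniform on $(0,1)$. A clock of rate $R(T_L,E_1)$ (resp. $R(E_N,T_R)$) links site $1$ to the left bath (resp. site $N$ to the right bath); when it rings, $E_1$ becomes $p(E_1+X_L)$ (resp. $E_N$ becomes $p(E_N+X_R)$), with $p$ uniform on $(0,1)$ and $X_L$ (resp. $X_R$) exponential with mean $T_L$ (resp. $T_R$). All clocks and random variables are independent. $P^t$ is the transition kernel and $(P^hV)(\mathbf{E})=\mathbb{E}_{\mathbf{E}}[V(\mathbf{E}_h)]$. Let $a_m=1-\frac{2^{m-1}-1}{2^N-1}$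 ($m=1,\dots,N$), $V_{m,k}(\mathbf{E})=\big(\sum_{j=0}^{m-1}E_{k+j}\big)^{a_m\eta-1}$ for $1\le m\le N$, $1\le k\le N-m+1$, and $V(\mathbf{E})=\sum_{m=1}^N\sum_{k=1}^{N-m+1}V_{m,k}(\mathbf{E})$. *)

(* Defs.v *)
From HB Require Import structures.
From mathcomp Require Import all_boot all_order all_algebra.
From mathcomp Require Import all_classical all_reals all_analysis.
Set Implicit Arguments. Unset Strict Implicit. Unset Printing Implicit Defensive.
Import Order.TTheory GRing.Theory Num.Theory.
Import numFieldNormedType.Exports.
Local Open Scope classical_set_scope.
Local Open Scope ring_scope.

Section SEEM.
Variable R : realType.

(* Configurations: E : nat -> R, only coordinates 0..N-1 are meaningful
   (site i of the paper, 1 <= i <= N, is coordinate i-1). *)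

Definition rate (K a b : R) : R := Num.min K (Num.sqrt (Num.min a b)).

Definition upd (E : nat -> R) (i : nat) (x : R) : nat -> R :=
  fun j => if j == i then x else E j.

Definition exch (E : nat -> R) (i : nat) (p : R) : nat -> R :=
  upd (upd E i (p * (E i + E i.+1))) i.+1 ((1 - p) * (E i + E i.+1)).


Definition inner_jump (f : (nat -> R) -> \bar R) (E : nat -> R) (i : nat)
  : \bar R :=
  (\int[lebesgue_measure]_(p in `]0%R, 1%R[) f (exch E i p))%E.

Definition bath_jump (T : R) (f : (nat -> R) -> \bar R) (E : nat -> R)
  (i : nat) : \bar R :=
  (\int[lebesgue_measure]_(p in `]0%R, 1%R[)
     \int[lebesgue_measure]_(x in `]0%R, +oo[)
        ((T^-1 * expR (- x / T))%:E * f (upd E i (p * (E i + x)))))%E.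

(* total rate bound used for uniformization: each of the N+1 clocks has
   rate <= K *)
Definition lam (N : nat) (K : R) : R := N.+1%:R * K.

Definition total_rate (N : nat) (TL TR K : R) (E : nat -> R) : R :=
  rate K TL (E 0%N) + rate K (E N.-1) TR +
  \sum_(0 <= i < N.-1) rate K (E i) (E i.+1).

(* One-step kernel of the uniformized chain: Q = I + G / lam, where G is the
   generator of the jump process described in the paper. *)
Definition Qop (N : nat) (TL TR K : R) (f : (nat -> R) -> \bar R)
  (E : nat -> R) : \bar R :=
  ((1 - total_rate N TL TR K E / lam N K)%:E * f E
   + (rate K TL (E 0%N) / lam N K)%:E * bath_jump TL f E 0
   + (rate K (E N.-1) TR / lam N K)%:E * bath_jump TR f E N.-1
   + \sum_(0 <= i < N.-1) ((rate K (E i) (E i.+1) / lam N K)%:E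
                            * inner_jump f E i))%E.

(* Transition semigroup (P^t f)(E) = E_E[f(E_t)] for nonnegative f, given by
   the uniformization series P^t = sum_n e^{-lam t} (lam t)^n / n! Q^n
   (valid since all clock rates are bounded by K). *)
Definition Pt (N : nat) (TL TR K : R) (t : R) (f : (nat -> R) -> \bar R)
  (E : nat -> R) : \bar R :=
  (\sum_(0 <= n <oo)
     ((expR (- (lam N K * t)) * (lam N K * t) ^+ n / n`!%:R)%:E
      * iter n (Qop N TL TR K) f E))%E.

Definition a_coef (N m : nat) : R :=
  1 - ((2 ^ m.-1)%:R - 1) / ((2 ^ N)%:R - 1).

(* V_{m,k}(E) = (sum_{j=0}^{m-1} E_{k+j})^(a_m eta - 1), k 1-based in the
   paper; here k0 = k-1 ranges over 0..N-m *)
Definition Vmk (N : nat) (eta : R) (m k0 : nat) (E : nat -> R) : R :=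
  (\sum_(0 <= j < m) E (k0 + j)%N) `^ (a_coef N m * eta - 1).

Definition Vfun (N : nat) (eta : R) (E : nat -> R) : R :=
  \sum_(1 <= m < N.+1) \sum_(0 <= k0 < N - m + 1) Vmk N eta m k0 E.

End SEEM.

(* Main.v *)
Require Import Defs.
From HB Require Import structures.
From mathcomp Require Import all_boot all_order all_algebra.
From mathcomp Require Import all_classical all_reals all_analysis.
From mathcomp Require Import measurable_realfun.
From mathcomp Require Import ring lra zify.
Set Implicit Arguments. Unset Strict Implicit. Unset Printing Implicit Defensive.
Import Order.TTheory GRing.Theory Num.Theory.
Import numFieldNormedType.Exports.
Local Open Scope classical_set_scope.
Local Open Scope ring_scope.

(* A clock of rate [g] on the boundary of an interval [I] of energy [S_I] removes
   [g * S_I^(-q_I)] from [V] and gives back at most a constant times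
   [g * S_J^(-q_I)], where [J] is [I] extended across that clock; clocks away from
   the boundary of [I] leave [S_I] unchanged.  Let [D] be the total removed.  If [u]
   is the smaller of the two energies at the right boundary of [J], then [D]
   dominates both [u^(1/2) S_J^(-q_J)] (from [J]) and [u^(eta - 1/2)] (from the
   single site of energy [u]); a weighted geometric mean eliminates [u] and leaves
   [D >= S_J^(-q_J alpha)].  Hence [D] dominates [V^alpha] up to constants.
   Moreover, for [2^N eta < 1] the coefficients [a_m] make [S^(1/2 - q_I)] of lower
   order than [S^(-q_J alpha)] as [S] tends to 0, so the returned terms are absorbed
   in [D].  Thus one step of the uniformized chain sends [V] below
   [V - c V^alpha + C]; later steps add at most [C] each, and averaging over the
   Poisson number of steps gives the bound once [V^alpha] is large. *)

(** * Integrals over the exchange fraction and the bath energy *)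

Ltac lra_itv := intros; try (apply/andP; split); lra.

(* No measurability is assumed: none is known for the iterates of [Qop]. *)
Lemma ge0_le_integral_nonmeas d (T : measurableType d) (R : realType)
    (mu : {measure set T -> \bar R}) (D : set T) (f g : T -> \bar R) :
  (forall x, D x -> 0 <= f x)%E -> (forall x, D x -> f x <= g x)%E ->
  (\int[mu]_(x in D) f x <= \int[mu]_(x in D) g x)%E.
Proof.
move=> f0 fg.
have g0 x : D x -> (0 <= g x)%E by move=> Dx; rewrite (le_trans (f0 _ Dx)) ?fg.
rewrite !ge0_integralE//; apply: ge_ereal_sup => _ [h hf <-].
apply: ereal_sup_ubound; exists h => // x; apply: (le_trans (hf x)).
by rewrite !patchE; case: ifPn => // xD; apply: fg; rewrite inE in xD.
Qed.

(** The integrand may blow up at both ends, so the fundamental theorem of calculus is applied on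
    compact intervals exhausting the open one; monotone convergence keeps the bound [M]. *)
Lemma integral01_le_primitive (R : realType) (f F : R -> R) (M : R) :
  (forall x : R, 0 < x < 1 -> 0 <= f x) ->
  (forall x : R, 0 < x < 1 -> {for x, continuous f}) ->
  (forall x : R, 0 < x < 1 -> is_derive x 1 F (f x)) ->
  (forall x y : R, 0 < x < 1 -> 0 < y < 1 -> F y - F x <= M) ->
  measurable_fun `](0 : R), 1[ f /\
  (\int[lebesgue_measure]_(x in `]0%R, 1%R[) (f x)%:E <= M%:E)%E.
Proof.
move=> f0 fc Ff FM.
have mf : measurable_fun `](0 : R), 1[ f.
  apply: open_continuous_measurable_fun => //.
  by move=> x; rewrite inE/= in_itv/=; exact: fc.
split => //.
(* The offset 3 keeps [d n] below one half, so every interval [A n] is nondegenerate. *)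
pose d n : R := n.+3%:R^-1.
have d0 n : 0 < d n by rewrite invr_gt0 ltr0n.
have d3 n : d n <= 3^-1 by rewrite lef_pV2 ?posrE ?ltr0n// ler_nat.
pose A n := `[d n, 1 - d n]%classic.
have nA : nondecreasing_seq A.
  move=> m n mn; rewrite subsetEset; apply: subset_itv; rewrite bnd_simp.
    by rewrite /d lef_pV2 ?posrE ?ltr0n// ler_nat !ltnS.
  by rewrite lerD2l lerN2 /d lef_pV2 ?posrE ?ltr0n// ler_nat !ltnS.
have Asub n : A n `<=` `](0:R), 1[.
  move=> x; rewrite /A/= in_itv/= => /andP[h1 h2]; rewrite in_itv/=.
  have := d0 n; lra_itv.
have Ucap : `](0:R), 1[%classic = \bigcup_n A n.
  rewrite eqEsubset; split; last by apply: bigcup_sub => n _; exact: Asub.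
  move=> x /=; rewrite in_itv/= => /andP[x0 x1].
  pose y := Num.min x (1 - x).
  have y0 : 0 < y by rewrite /y lt_min x0 subr_gt0.
  exists (Num.truncn y^-1) => //=; rewrite /A/= in_itv/=.
  have dy : d (Num.truncn y^-1) <= y.
    rewrite /d invf_ple ?posrE ?ltr0n//.
    apply: (le_trans (ltW (truncnS_gt _))); rewrite ler_nat.
    by rewrite -addn2 leq_addr.
  have yx : y <= x by rewrite /y ge_min lexx.
  have yx1 : y <= 1 - x by rewrite /y ge_min lexx orbT.
  lra_itv.
rewrite Ucap.
have mfA n : measurable_fun (A n) (EFin \o f).
  by apply/measurable_EFinP; exact: (measurable_funS (measurable_itv _) (@Asub n) mf).
have f0A n x : A n x -> (0 <= (EFin \o f) x)%E.
  by move=> /Asub/=; rewrite in_itv/= lee_fin; exact: f0.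
have /cvg_lim <- // := @ge0_nondecreasing_set_cvg_integral _ (measurableTypeR R) R
  A (EFin \o f) lebesgue_measure nA (fun=> measurable_itv _) mfA f0A.
apply: lime_le.
  apply: ereal_nondecreasing_is_cvgn.
  apply: (@ge0_nondecreasing_set_nondecreasing_integral _ (measurableTypeR R)) => //.
  by move=> i; exact: measurable_itv.
apply: nearW => n /=.
have dn : d n < 1 - d n by have := d0 n; have := d3 n; lra_itv.
rewrite (@continuous_FTC2 _ f F)//.
- rewrite -EFinB lee_fin; apply: FM; have := d0 n; have := d3 n; lra_itv.
- apply: continuous_in_subspaceT => x; rewrite inE => /Asub/=.
  by rewrite in_itv/=; exact: fc.
- have Fc x : 0 < x < 1 -> {for x, continuous F}.
    move=> /Ff [+ _] => /derivable1_diffP.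
    exact: differentiable_continuous.
  split.
  + move=> x xA; have /Ff[]// : 0 < x < 1.
    by move: xA; rewrite in_itv/=; have := d0 n; lra_itv.
  + by apply: cvg_at_right_filter; apply: Fc; have := d0 n; have := d3 n; lra_itv.
  + by apply: cvg_at_left_filter; apply: Fc; have := d0 n; have := d3 n; lra_itv.
- move=> x xA; rewrite derive1E; have /Ff[_ ->]// : 0 < x < 1.
  by move: xA; rewrite in_itv/=; have := d0 n; lra_itv.
Qed.

(** An exchange leaves the shares [p] and [1 - p]; this symmetric weight controls negative powers of
    both. *)
Definition phi01 (R : realType) (Q p : R) : R := p `^ (- Q) + (1 - p) `^ (- Q).

Lemma integral_phi01 (R : realType) (Q : R) : 0 < Q -> Q < 1 ->
  measurable_fun `](0 : R), 1[ (phi01 Q) /\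
  (\int[lebesgue_measure]_(x in `]0%R, 1%R[) (phi01 Q x)%:E <= (2 / (1 - Q))%:E)%E.
Proof.
move=> Q0 Q1.
have r0 : 0 < 1 - Q by rewrite subr_gt0.
apply: (@integral01_le_primitive _ (phi01 Q)
  (fun x => (1 - Q)^-1 * (x `^ (1 - Q) - (1 - x) `^ (1 - Q)))).
- by move=> x _; rewrite addr_ge0 ?powR_ge0.
- move=> x /andP[x0 x1].
  have cp (y : R) : 0 < y -> {for y, continuous (fun z : R => z `^ (- Q))}.
    move=> y0; apply: differentiable_continuous; apply/derivable1_diffP.
    by apply: derivable_powR; rewrite in_itv/= y0.
  apply: continuousD; first exact: cp.
  apply: (@continuous_comp _ _ _ (fun z : R => 1 - z) (fun z => z `^ (- Q))).
    by apply: continuousB => //; exact: cvg_cst.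
  by apply: cp; rewrite subr_gt0.
- move=> x /andP[x0 x1].
  have x1' : 0 < 1 - x by rewrite subr_gt0.
  have D1 := @is_derive1_powR R (1 - Q) x x0.
  have D2 := @is_derive1_powR R (1 - Q) (1 - x) x1'.
  have D3 : is_derive x (1:R) (fun z : R => 1 - z) (-1).
    have -> : -1 = 0 - 1 :> R by rewrite sub0r.
    by apply: is_deriveB.
  have D4 := @is_derive1_comp R (fun z => z `^ (1 - Q)) (fun z => 1 - z) x _ _ D2 D3.
  have D5 := is_deriveZ ((1 - Q)^-1) (is_deriveB D1 D4).
  apply: (is_derive_eq D5).
  rewrite /phi01 /GRing.scale/=.
  have -> : 1 - Q - 1 = - Q by ring.
  by field; rewrite gt_eqF.
(* All powers lie in [0, 1], so their difference varies by at most 2. *)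
- move=> x y /andP[x0 x1] /andP[y0 y1].
  have b (z : R) : 0 < z -> z < 1 -> 0 <= z `^ (1 - Q) <= 1.
    move=> z0 z1; rewrite powR_ge0/=.
    apply: (@le_trans _ _ (1 `^ (1 - Q))); last by rewrite powR1.
    by rewrite ge0_ler_powR ?nnegrE// ltW.
  rewrite -mulrBr mulrC ler_pM2r ?invr_gt0//.
  have := b _ x0 x1; have := b _ y0 y1.
  have := b (1-x); have := b (1 - y).
  by move=> /(_ ltac:(lra) ltac:(lra)) ? /(_ ltac:(lra) ltac:(lra)); lra.
Qed.

Lemma integral_exp_density (R : realType) (T : R) : 0 < T ->
  measurable_fun `](0 : R), +oo[ (fun x : R => T^-1 * expR (- x / T)) /\
  (\int[lebesgue_measure]_(x in `]0%R, +oo[) (T^-1 * expR (- x / T))%:E = 1%:E)%E.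
Proof.
move=> T0.
have mf : measurable_fun setT (fun x : R => T^-1 * expR (- x / T)).
  apply: measurable_funM => //; apply: measurableT_comp => //.
  by apply: measurable_funM => //; exact: measurableT_comp.
split; first exact: measurable_funTS.
rewrite integral_itv_obnd_cbnd; last by apply/measurable_EFinP; exact: measurable_funTS.
rewrite integral_mkcond -(@integral_exponential_pdf R T^-1) ?invr_gt0//.
apply: eq_integral => x _; rewrite /exponential_pdf !patchE.
by case: ifPn => // _; rewrite mulNr mulNr [x / T]mulrC.
Qed.

Lemma integral_phi01_affine (R : realType) (Q C b c : R) : 0 < Q -> Q < 1 ->
  2 / (1 - Q) <= C -> 0 <= b -> 0 <= c ->
  (\int[lebesgue_measure]_(p in `]0%R, 1%R[) (b + c * phi01 Q p)%:E
    <= (b + c * C)%:E)%E.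
Proof.
move=> Q0 Q1 QC b0 c0; have [mphi Iphi] := integral_phi01 Q0 Q1.
under eq_integral do rewrite EFinD EFinM.
have mphi' : measurable_fun `](0 : R), 1[ (EFin \o phi01 Q) by exact/measurable_EFinP.
have phi0 x : (0 <= (phi01 Q x)%:E)%E by rewrite lee_fin addr_ge0 ?powR_ge0.
rewrite ge0_integralD//=; last 2 first.
- by move=> x _; rewrite mule_ge0.
- by apply: measurable_funeM.
rewrite ge0_integralZl_EFin//= EFinD leeD//.
  rewrite (integral_cst lebesgue_measure (measurable_itv `](0:R), 1[)).
  have := lebesgue_measure_itv `](0 : R), 1[.
  by rewrite /= lte_fin ltr01 oppr0 adde0 => ->; rewrite mule1.
by rewrite EFinM lee_wpmul2l ?lee_fin// (le_trans Iphi)// lee_fin.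
Qed.

(** Below 1 the density is at most [T^-1] and x^(-Q) is integrable; from 1 on, x^(-Q) is at most 1.
    [C] is chosen before [b] and [c], which later carry the configuration. *)
Lemma integral_exp_density_powR (R : realType) (T Q : R) :
  0 < T -> 0 < Q -> Q < 1 ->
  exists2 C, 0 <= C & forall b c, 0 <= b -> 0 <= c ->
  (\int[lebesgue_measure]_(x in `]0%R, +oo[)
     ((T^-1 * expR (- x / T))%:E * (b + c * (1 + x `^ (- Q)))%:E)
    <= (b + c * C)%:E)%E.
Proof.
move=> T0 Q0 Q1; have [mphi Iphi] := integral_phi01 Q0 Q1.
have [mdens Idens] := integral_exp_density T0.
have Q1' : 0 < 1 - Q by rewrite subr_gt0.
exists (2 + T^-1 * (2 / (1 - Q))).
  by rewrite addr_ge0// mulr_ge0 ?divr_ge0// ?invr_ge0 ltW.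
move=> b c b0 c0.
have phi0 x : (0 <= (phi01 Q x)%:E)%E by rewrite lee_fin addr_ge0 ?powR_ge0.
pose psi := (fun x : R => (phi01 Q x)%:E) \_ `]0%R, 1%R[.
have psi0 x : (0 <= psi x)%E by rewrite /psi patchE; case: ifP.
have mpsi : measurable_fun `](0 : R), +oo[ psi.
  apply: measurable_funTS; apply/(measurable_restrictT _ (measurable_itv _)).
  exact/measurable_EFinP.
have dens0 x : 0 <= T^-1 * expR (- x / T) by rewrite mulr_ge0 ?expR_ge0// invr_ge0 ltW.
have Ti0 : 0 <= T^-1 by rewrite invr_ge0 ltW.
have I2 : (\int[lebesgue_measure]_(x in `]0%R, +oo[) psi x <= (2 / (1 - Q))%:E)%E.
  rewrite /psi -integral_mkcondr (_ : _ `&` _ = `](0 : R), 1[%classic)//.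
  apply/seteqP; split => x /=; first by case.
  by rewrite !in_itv/= => /andP[-> ->].
apply: (@le_trans _ _ (\int[lebesgue_measure]_(x in `]0%R, +oo[)
     ((b + 2 * c)%:E * (T^-1 * expR (- x / T))%:E + (c * T^-1)%:E * psi x))%E).
  apply: ge0_le_integral_nonmeas => x; rewrite /= in_itv/= andbT => x0.
    by rewrite -EFinM lee_fin mulr_ge0// addr_ge0// mulr_ge0// addr_ge0// powR_ge0.
  rewrite /psi patchE; case: ifPn.
    rewrite inE/= in_itv/= => /andP[_ x1]; rewrite -!EFinM -EFinD lee_fin.
    rewrite [leRHS](_ : _ = T^-1 * expR (- x / T) * (b + 2 * c) +
      T^-1 * (c * phi01 Q x)); last by ring.
    have e1 : expR (- x / T) <= 1.
      by rewrite -(expR0 R) ler_expR mulNr oppr_le0 divr_ge0// ltW.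
    have h : T^-1 * expR (- x / T) * (c * x `^ (- Q)) <= T^-1 * (c * phi01 Q x).
      apply: ler_pM => //; first by rewrite mulr_ge0 ?powR_ge0.
        by apply: ler_piMr.
      by rewrite ler_wpM2l// /phi01 lerDl powR_ge0.
    have := mulr_ge0 (dens0 x) c0; lra.
  rewrite notin_setE/= in_itv/= x0/= => /negP; rewrite -leNgt => x1.
  rewrite mule0 adde0 -!EFinM lee_fin [leRHS]mulrC ler_wpM2l//.
  have xQ : x `^ (- Q) <= 1.
    rewrite powRN invf_le1 ?powR_gt0// -(powRr0 x).
    by apply: ler_powR => //; exact: ltW.
  have := ler_wpM2l c0 xQ; lra.
rewrite ge0_integralD//=; last 4 first.
- by move=> x _; rewrite -EFinM lee_fin mulr_ge0// addr_ge0// mulr_ge0.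
- by apply: measurable_funeM; exact/measurable_EFinP.
- by move=> x _; rewrite mule_ge0// lee_fin mulr_ge0.
- by apply: measurable_funeM.
rewrite ge0_integralZl_EFin//=; last 3 first.
- by move=> x _; rewrite lee_fin.
- exact/measurable_EFinP.
- by rewrite addr_ge0// mulr_ge0.
rewrite ge0_integralZl_EFin//=; last by rewrite mulr_ge0.
rewrite Idens mule1.
have -> : b + c * (2 + T^-1 * (2 / (1 - Q))) = b + 2 * c + c * T^-1 * (2 / (1 - Q)).
  by field; rewrite !gt_eqF.
rewrite [leRHS]EFinD leeD2l// [leRHS]EFinM.
by rewrite lee_wpmul2l// lee_fin mulr_ge0.
Qed.

(** * Power inequalities and the arithmetic of the exponents *)

Section Scalar.
Variable R : realType.

Lemma gt0_powRD (x r s : R) : 0 < x -> x `^ (r + s) = x `^ r * x `^ s.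
Proof. by move=> x0; rewrite powRD// (gt_eqF x0) implybT. Qed.

Lemma two_expn_gt0 N : (0 < N)%N -> 0 < (2 ^ N)%:R - 1 :> R.
Proof.
move=> N0; rewrite subr_gt0 ltr1n; case: N N0 => // n _.
by rewrite expnS (leq_trans (n := 2 * 1)%N)// leq_mul2l expn_gt0.
Qed.

Lemma a_coef1 N : a_coef R N 1 = 1.
Proof. by rewrite /a_coef/= expn0 subrr mul0r subr0. Qed.

Lemma a_coef_itv N m : (0 < m)%N -> (m <= N)%N -> 2^-1 <= a_coef R N m <= 1.
Proof.
move=> m0 mN; have N0 : (0 < N)%N by exact: leq_trans mN.
have d0 := two_expn_gt0 N0.
have hm : (2 ^ m.-1)%:R * 2 <= (2 ^ N)%:R :> R.
  by rewrite -natrM ler_nat -expnSr prednK// leq_exp2l.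
have h1 : 1 <= (2 ^ m.-1)%:R :> R by rewrite ler1n expn_gt0.
rewrite /a_coef; apply/andP; split.
  rewrite lerBrDl -lerBrDr ler_pdivrMr//; lra.
rewrite lerBlDr lerDl divr_ge0//; lra.
Qed.

(** The doubling in [a_coef] makes 2 a_m - a_(m+1) - 1 the same positive number for every m. This is
    the room between the exponents to leading order in [eta]; the second identity measures the
    correction. *)
Lemma a_coef_gap N m : (0 < m)%N -> (m < N)%N ->
  (2 * a_coef R N m - a_coef R N m.+1 - 1) * ((2 ^ N)%:R - 1) = 1 /\
  (a_coef R N m - a_coef R N m.+1) * ((2 ^ N)%:R - 1) = 2^-1 * (2 ^ m)%:R.
Proof.
move=> m0 mN; have /two_expn_gt0 d0 : (0 < N)%N by exact: leq_trans mN.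
have -> : (2 ^ m)%:R = 2 * (2 ^ m.-1)%:R :> R.
  by rewrite -natrM -expnS prednK.
rewrite /a_coef/=.
have -> : (2 ^ m)%:R = 2 * (2 ^ m.-1)%:R :> R.
  by rewrite -natrM -expnS prednK.
by split; field; rewrite gt_eqF.
Qed.

(* [D] dominates both [u^(1/2) S^(-q)] and [u^(eta - 1/2)]; with weights
   [al] and [1 - al] the powers of [u] in their geometric mean cancel. *)
Lemma powR_geometric_mean (eta al q s u D : R) :
  0 < eta -> eta < 2^-1 -> al = 1 - (2 * (1 - eta))^-1 ->
  0 < s -> 0 < u -> Num.sqrt u * s `^ (- q) <= D ->
  Num.sqrt u * u `^ (eta - 1) <= D -> (s `^ (- q)) `^ al <= D.
Proof.
move=> e0 e2 alE s0 u0 h1 h2.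
have e1 : 0 < 1 - eta by lra.
have al01 : 0 < al < 1.
  have h : (2 * (1 - eta))^-1 < 1 by rewrite invf_lt1; lra.
  have h' : 0 < (2 * (1 - eta))^-1 by rewrite invr_gt0; lra.
  by rewrite alE; apply/andP; split; lra.
have [al0 al1] := andP al01.
have su0 : 0 < Num.sqrt u by rewrite sqrtr_gt0.
have D0 : 0 < D by apply: lt_le_trans h1; rewrite mulr_gt0 ?powR_gt0.
have {}h1 : (Num.sqrt u * s `^ (- q)) `^ al <= D `^ al.
  by apply: ge0_ler_powR; rewrite ?nnegrE ?mulr_ge0 ?powR_ge0// ltW.
have {}h2 : (Num.sqrt u * u `^ (eta - 1)) `^ (1 - al) <= D `^ (1 - al).
  by apply: ge0_ler_powR; rewrite ?nnegrE ?mulr_ge0 ?powR_ge0 ?subr_ge0// ltW.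
have := ler_pM (powR_ge0 _ _) (powR_ge0 _ _) h1 h2.
rewrite -(gt0_powRD _ _ D0) (addrC al) subrK (powRr1 (ltW D0)); apply: le_trans.
rewrite -(powR12_sqrt (ltW u0)) -gt0_powRD//.
rewrite powRM ?powR_ge0// -2!(powRrM u) [leRHS]mulrAC -gt0_powRD//.
have -> : 2^-1 * al + (2^-1 + (eta - 1)) * (1 - al) = 0.
  by rewrite alE; field; rewrite gt_eqF.
by rewrite powRr0 mul1r.
Qed.

(** For small [s] the factor [g] gains half a power, and below the threshold [d] the exponent gap p
    + 1/2 - q turns this into a factor at most [c]. Above [d], both [g] and s^(-q) are bounded. *)
Lemma powR_absorb (K c q p : R) : 0 < c -> 0 <= K -> 0 <= q -> q < p + 2^-1 ->
  exists2 C, 0 <= C & forall s g : R, 0 < s -> 0 <= g -> g <= K ->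
   g <= Num.sqrt s -> g * s `^ (- q) <= c * s `^ (- p) + C.
Proof.
move=> c0 K0 q0 qp.
have b0 : 0 < p + 2^-1 - q by rewrite subr_gt0.
pose d := c `^ (p + 2^-1 - q)^-1.
have d0 : 0 < d by rewrite powR_gt0.
exists (K * d `^ (- q)); first by rewrite mulr_ge0 ?powR_ge0.
move=> s g s0 g0 gK gs; have [sd|ds] := leP s d.
  rewrite ler_wpDr ?mulr_ge0 ?powR_ge0//.
  apply: (@le_trans _ _ (Num.sqrt s * s `^ (- q))).
    by rewrite ler_wpM2r ?powR_ge0.
  rewrite -(powR12_sqrt (ltW s0)) -gt0_powRD//.
  have -> : 2^-1 - q = (p + 2^-1 - q) + - p by ring.
  rewrite gt0_powRD//.
  rewrite ler_wpM2r ?powR_ge0//.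
  have -> : c = d `^ (p + 2^-1 - q).
    by rewrite /d -powRrM mulVf ?gt_eqF// powRr1// ltW.
  by apply: ge0_ler_powR; rewrite ?nnegrE// ltW.
rewrite ler_wpDl ?mulr_ge0 ?powR_ge0 ?(ltW c0)//.
apply: ler_pM; rewrite ?powR_ge0//.
rewrite !powRN lef_pV2 ?posrE ?powR_gt0//.
by apply: ge0_ler_powR; rewrite ?nnegrE// ltW.
Qed.

(** Each [F i] is at most the sum S and [al - 1 <= 0], so F_i S^(al - 1) <= F_i^al; sum over i. *)
Lemma powR_le_sum (I : eqType) (r : seq I) (F : I -> R) (al : R) :
  0 < al -> al <= 1 -> (forall i, i \in r -> 0 < F i) ->
  (\sum_(i <- r) F i) `^ al <= \sum_(i <- r) F i `^ al.
Proof.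
move=> al0 al1 F0.
set S := \sum_(i <- r) F i.
have S0 : 0 <= S by rewrite /S big_seq sumr_ge0// => i ir; rewrite ltW ?F0.
have [->|Sn0] := eqVneq S 0.
  by rewrite powR0 ?gt_eqF// big_seq sumr_ge0// => i ir; rewrite powR_ge0.
have Sgt0 : 0 < S by rewrite lt_def Sn0.
rewrite -(mulr_powRB1 S0 al0) {1}/S mulr_suml.
rewrite big_seq [leRHS]big_seq; apply: ler_sum => i ir.
rewrite -(mulr_powRB1 (ltW (F0 _ ir)) al0) ler_wpM2l ?(ltW (F0 _ ir))//.
have FS : F i <= S.
  rewrite /S (big_rem i)//= lerDl big_seq sumr_ge0// => j /mem_rem jr.
  by rewrite ltW ?F0.
rewrite -(opprB 1 al) !powRN lef_pV2 ?posrE ?powR_gt0 ?F0//.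
by apply: ge0_ler_powR; rewrite ?nnegrE ?subr_ge0 ?(ltW (F0 _ ir)).
Qed.

(** The gap p al + 1/2 - q equals eta / (2 (1 - eta)) times the quantity in the last hypothesis. *)
Lemma powR_Nexp_le (eta al q p : R) (a a' : R) :
  eta < 2^-1 -> 0 < eta -> al = 1 - (2 * (1 - eta))^-1 ->
  q = 1 - a * eta -> p = 1 - a' * eta ->
  0 < 2 * a - a' - 1 - 2 * (a - a') * eta ->
  q < p * al + 2^-1.
Proof.
move=> e2 e0 -> -> -> h.
have e1 : 0 < 1 - eta by lra.
rewrite -subr_gt0.
have -> : (1 - a' * eta) * (1 - (2 * (1 - eta))^-1) + 2^-1 - (1 - a * eta)
   = eta * (2 * a - a' - 1 - 2 * (a - a') * eta) / (2 * (1 - eta)).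
  by field; rewrite gt_eqF.
by rewrite divr_gt0 ?mulr_gt0.
Qed.

End Scalar.

(** * Jump integrals of functions with an affine bound *)

Lemma inner_jump_affine_bound (R : realType) (Q C b c : R) f E i :
  0 < Q -> Q < 1 -> 2 / (1 - Q) <= C -> 0 <= b -> 0 <= c ->
  (forall p, 0 < p < 1 -> (0 <= f (exch E i p) <= (b + c * phi01 Q p)%:E)%E) ->
  (0 <= inner_jump f E i <= (b + c * C)%:E)%E.
Proof.
move=> Q0 Q1 QC b0 c0 H.
have H0 p : `]0%R, 1%R[%classic p -> (0 <= f (exch E i p))%E.
  by rewrite /= in_itv/= => /H/andP[].
apply/andP; split; first exact: integral_ge0.
apply: (le_trans _ (integral_phi01_affine Q0 Q1 QC b0 c0)).
apply: ge0_le_integral_nonmeas => // p; rewrite /= in_itv/= => /H/andP[_].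
exact.
Qed.

Lemma bath_jump_affine_bound (R : realType) (T Q : R) : 0 < T -> 0 < Q -> Q < 1 ->
  exists2 C, 0 <= C & forall b c f E i, 0 <= b -> 0 <= c ->
  (forall p x, 0 < p < 1 -> 0 < x ->
    (0 <= f (upd E i (p * (E i + x))) <=
      (b + c * (phi01 Q p * (1 + x `^ (- Q))))%:E)%E) ->
  (0 <= bath_jump T f E i <= (b + c * C)%:E)%E.
Proof.
move=> T0 Q0 Q1; have [C1 C10 H1] := integral_exp_density_powR T0 Q0 Q1.
have Q1' : 0 < 1 - Q by rewrite subr_gt0.
exists (C1 * (2 / (1 - Q))); first by rewrite mulr_ge0// divr_ge0// ltW.
move=> b c f E i b0 c0 H.
have dens0 x : 0 <= T^-1 * expR (- x / T).
  by rewrite mulr_ge0 ?expR_ge0// invr_ge0 ltW.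
have in0 p : `]0%R, 1%R[%classic p -> (0 <= \int[lebesgue_measure]_(x in `]0%R, +oo[)
   ((T^-1 * expR (- x / T))%:E * f (upd E i (p * (E i + x)))))%E.
  rewrite /= in_itv/= => p01; apply: integral_ge0 => x; rewrite /= in_itv/= andbT => x0.
  by rewrite mule_ge0 ?lee_fin//; have /andP[] := H p x p01 x0.
apply/andP; split; first exact: integral_ge0.
rewrite mulrA.
apply: (le_trans _ (integral_phi01_affine Q0 Q1 (lexx _) b0 (mulr_ge0 c0 C10))).
apply: ge0_le_integral_nonmeas => // p; rewrite /= in_itv/= => p01.
have phi0 : 0 <= phi01 Q p by rewrite addr_ge0 ?powR_ge0.
rewrite mulrAC; apply: (le_trans _ (H1 _ _ b0 (mulr_ge0 c0 phi0))).
apply: ge0_le_integral_nonmeas => x; rewrite /= in_itv/= andbT => x0.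
  by rewrite mule_ge0 ?lee_fin//; have /andP[] := H p x p01 x0.
have /andP[_ h] := H p x p01 x0.
by rewrite lee_wpmul2l ?lee_fin// -mulrA.
Qed.

(** * Interval energies under an update *)

Section Segments.
Variable R : realType.
Implicit Types (E : nat -> R).

Definition seg E (m k : nat) : R := \sum_(0 <= j < m) E (k + j)%N.

Lemma segS E m k : seg E m.+1 k = seg E m k + E (k + m)%N.
Proof. by rewrite /seg big_nat_recr. Qed.

Lemma segSl E m k : seg E m.+1 k = E k + seg E m k.+1.
Proof.
rewrite /seg big_nat_recl// addn0; congr (_ + _).
by apply: eq_bigr => j _; rewrite addnS addSn.
Qed.

Lemma seg_upd E i x m k :
  seg (upd E i x) m k = seg E m k + (x - E i) * (k <= i < k + m)%N%:R.
Proof.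
elim: m => [|m IH].
  rewrite /seg !big_geq// (_ : (_ <= _ < _)%N = false) ?mulr0 ?addr0//.
  by apply/negbTE; lia.
rewrite !segS IH /upd; case: eqP => [<-|ne].
  rewrite (_ : (k <= k + m < k + m)%N = false); last by lia.
  rewrite (_ : (k <= k + m < k + m.+1)%N = true); last by lia.
  by rewrite mulr0n mulr1n; ring.
rewrite (_ : (k <= i < k + m.+1)%N = (k <= i < k + m)%N); last by lia.
by rewrite addrAC.
Qed.

(** The exchange conserves the energy of the pair, so an interval changes only if it contains
    exactly one of the two sites; the difference of indicators records which one. *)
Lemma seg_exch E i p m k :
  seg (exch E i p) m k = seg E m k +
  (p * (E i + E i.+1) - E i) * ((k <= i < k + m)%N%:R - (k <= i.+1 < k + m)%N%:R).
Proof.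
rewrite /exch !seg_upd (_ : upd E i _ i.+1 = E i.+1) ?/upd ?(gtn_eqF (ltnSn i))//; ring.
Qed.

Lemma seg_ge0 E m k : (forall j, (k <= j < k + m)%N -> 0 < E j) -> 0 <= seg E m k.
Proof.
move=> E0; rewrite /seg big_nat sumr_ge0// => j /andP[_ jm].
by apply/ltW/E0; lia.
Qed.

Lemma le_seg E m k i : (forall j, (k <= j < k + m)%N -> 0 < E j) ->
  (k <= i < k + m)%N -> E i <= seg E m k.
Proof.
elim: m => [|m IH] E0 ikm; first lia.
rewrite segS; have [->|ne] := eqVneq i (k + m)%N.
  by rewrite lerDr seg_ge0// => j jm; apply: E0; lia.
rewrite ler_wpDr//; first by apply/ltW/E0; lia.
by apply: IH => [j jm|]; [apply: E0|]; lia.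
Qed.

Lemma seg_gt0 E m k : (0 < m)%N -> (forall j, (k <= j < k + m)%N -> 0 < E j) ->
  0 < seg E m k.
Proof.
move=> m0 E0; apply: (lt_le_trans (E0 k _)); first lia.
by apply: le_seg => //; lia.
Qed.

End Segments.

(** * Single terms of [V] under a single jump *)

Section Intervals.
Variables (R : realType) (N : nat) (eta : R).
Implicit Types (E : nat -> R) (I : nat * nat).

(* [(m, k)] stands for the sites [k, ..., k + m - 1], counted from 0. *)
Definition ivs : seq (nat * nat) :=
  [seq (m, k) | m <- index_iota 1 N.+1, k <- index_iota 0 (N - m + 1)].

Lemma mem_ivs m k : ((m, k) \in ivs) = (0 < m)%N && (k + m <= N)%N.
Proof.
apply/allpairsPdep/idP => [[m' [k' []]]|/andP[m0 kN]].
  by rewrite !mem_index_iota => ? ? [-> ->]; lia.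
by exists m, k; rewrite !mem_index_iota; split => //; lia.
Qed.

Lemma Vfun_ivs E : Vfun N eta E = \sum_(I <- ivs) Vmk N eta I.1 I.2 E.
Proof. by rewrite /ivs big_allpairs_dep. Qed.

Definition positive_config E := forall i, (i < N)%N -> 0 < E i.

Lemma Vmk_gt0 E I : positive_config E -> I \in ivs -> 0 < Vmk N eta I.1 I.2 E.
Proof.
case: I => m k E0; rewrite mem_ivs => /andP[m0 kN] /=.
by rewrite powR_gt0// seg_gt0// => j jk; apply: E0; lia.
Qed.

Lemma Vfun_ge0 E : positive_config E -> 0 <= Vfun N eta E.
Proof.
by move=> E0; rewrite Vfun_ivs big_seq sumr_ge0// => I Ir; rewrite ltW ?Vmk_gt0.
Qed.

(** Edge [e] joins sites [e - 1] and [e], so the boundary edges of the sites k, ..., k + m - 1 are k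
    and k + m. *)
Definition crosses (e : nat) I := (e == I.2) || (e == I.2 + I.1)%N.

(* The energy of [I] after opening it across its boundary edge [e], raised to
   the exponent of [I]; at a bath the fresh energy has a bounded moment of that
   order, for which [1] stands. *)
Definition expanded E (e : nat) I : R :=
  if (e == 0%N) || (e == N) then 1
  else seg E I.1.+1 (if e == I.2 then I.2.-1 else I.2) `^ (a_coef R N I.1 * eta - 1).

Hypotheses (eta0 : 0 < eta) (eta1 : eta < 1).

(** The common bound [1 - eta / 2], which is below 1, lets a single integrable weight serve every
    interval. *)
Lemma V_exponent m : (0 < m)%N -> (m <= N)%N ->
  0 < 1 - a_coef R N m * eta <= 1 - eta / 2.
Proof.
move=> m0 mN; have /andP[h1 h2] := @a_coef_itv R N m m0 mN.
have := ler_wpM2r (ltW eta0) h1; have := ler_wpM2r (ltW eta0) h2.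
move: (a_coef R N m * eta) => t ht1 ht2; have := eta1; have := eta0.
by move=> *; apply/andP; split; lra.
Qed.

(** The factor s^(-q) splits off from (p s)^(-q); as [p < 1], raising the exponent from [q] to [Q]
    only increases p^(-q). *)
Lemma powR_thinning (q Q p s y : R) : 0 <= q -> q <= Q -> 0 < p < 1 -> 0 < s ->
  p * s <= y -> y `^ (- q) <= s `^ (- q) * phi01 Q p.
Proof.
move=> q0 qQ /andP[p0 p1] s0 psy.
have ps0 : 0 < p * s by rewrite mulr_gt0.
apply: (@le_trans _ _ ((p * s) `^ (- q))).
  rewrite !powRN lef_pV2 ?posrE ?powR_gt0 ?(lt_le_trans ps0)//.
  by apply: ge0_ler_powR => //; rewrite nnegrE; [exact: ltW|exact: le_trans (ltW ps0) psy].
rewrite powRM ?(ltW p0) ?(ltW s0)// mulrC ler_wpM2l ?powR_ge0//.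
rewrite ler_wpDr ?powR_ge0//; apply: ger_powR; rewrite ?lerN2//.
by rewrite p0 ltW.
Qed.

Lemma phi01C (Q p : R) : phi01 Q (1 - p) = phi01 Q p.
Proof. by rewrite /phi01 subKr addrC. Qed.

Lemma positive_exch E i p : positive_config E -> (i.+1 < N)%N -> 0 < p < 1 ->
  positive_config (exch E i p).
Proof.
move=> E0 iN /andP[p0 p1] j jN; have := E0 _ iN; have := E0 _ (ltnW iN) => a b.
rewrite /exch /upd; case: ifP => _; first by rewrite mulr_gt0 ?subr_gt0 ?p1 ?addr_gt0.
by case: ifP => _; [rewrite mulr_gt0 ?addr_gt0|exact: E0].
Qed.

Lemma Vmk_exch_le E e I p : positive_config E -> (0 < e < N)%N -> I \in ivs ->
  0 < p < 1 ->
  Vmk N eta I.1 I.2 (exch E e.-1 p) <=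
  (if crosses e I then 0 else Vmk N eta I.1 I.2 E) +
  (if crosses e I then expanded E e I else 0) * phi01 (1 - eta / 2) p.
Proof.
case: I => m k E0 eN; rewrite mem_ivs => /andP[m0 kN] p01 /=.
have mN : (m <= N)%N by lia.
have /andP[q0 qQ] := V_exponent m0 mN.
rewrite /expanded /crosses /Vmk /=.
rewrite -!/(seg _ _ _) -(opprB 1) seg_exch.
case: e eN => // i /= iN; rewrite (ltn_eqF iN).
have Ei := E0 _ (ltnW iN); have Ei1 := E0 _ iN.
have Es j : (k <= j < k + m)%N -> 0 < E j by move=> jk; apply: E0; lia.
case: ifPn => [|nc]; last first.
  rewrite mul0r addr0.
  rewrite (_ : (k <= i < k + m)%N = (k <= i.+1 < k + m)%N); last by lia.
  by rewrite subrr mulr0 addr0.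
rewrite add0r => /orP[/eqP ik|/eqP ikm].
  rewrite (_ : (k <= i < k + m)%N = false); last by lia.
  rewrite (_ : (k <= i.+1 < k + m)%N = true); last by lia.
  (* Site [k] receives the share [1 - p] and the rest of the interval keeps its energy, so at least
     the fraction [1 - p] of the expanded energy remains; [phi01C] swaps the roles of [p] and
     [1 - p]. *)
  rewrite ik eqxx -phi01C.
  move: p01 => /andP[p0 p1].
  apply: powR_thinning; rewrite ?(ltW q0)//; first by apply/andP; split; lra.
    apply: seg_gt0 => // j jk; apply: E0; lia.
  have hS : E k <= seg E m k by apply: le_seg => //; lia.
  rewrite -ik [_.-1]/= segSl ik -subr_ge0 [leRHS](_ : _ = p * (seg E m k - E k)).
    by rewrite mulr_ge0 ?subr_ge0 ?(ltW p0).
  by rewrite mulr0n mulr1n; ring.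
rewrite (_ : (i.+1 == k) = false); last by lia.
rewrite (_ : (k <= i < k + m)%N = true); last by lia.
rewrite (_ : (k <= i.+1 < k + m)%N = false); last by lia.
have /andP[p0 p1] := p01.
apply: powR_thinning; rewrite ?(ltW q0)//.
  by apply: seg_gt0 => // j jk; apply: E0; lia.
have hS : E i <= seg E m k by apply: le_seg => //; lia.
rewrite segS -ikm -subr_ge0 [leRHS](_ : _ = (1 - p) * (seg E m k - E i)).
  by rewrite mulr_ge0 ?subr_ge0 ?(ltW p1).
by rewrite mulr0n mulr1n; ring.
Qed.

Lemma positive_upd E i x : positive_config E -> 0 < x -> positive_config (upd E i x).
Proof. by move=> E0 x0 j jN; rewrite /upd; case: ifP => // _; exact: E0. Qed.

(** [minn e N.-1] is the site next to the bath at edge [e]. When it lies in the interval, the new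
    energy is at least [p * x], which gives a bound free of [E]. *)
Lemma Vmk_bath_le E e I p x : (0 < N)%N -> positive_config E -> (e == 0%N) || (e == N) ->
  I \in ivs -> 0 < p < 1 -> 0 < x ->
  Vmk N eta I.1 I.2 (upd E (minn e N.-1) (p * (E (minn e N.-1) + x))) <=
  (if crosses e I then 0 else Vmk N eta I.1 I.2 E) +
  (if crosses e I then expanded E e I else 0) *
    (phi01 (1 - eta / 2) p * (1 + x `^ (- (1 - eta / 2)))).
Proof.
case: I => m k N0 E0 eN; rewrite mem_ivs => /andP[m0 kN] p01 x0 /=.
have mN : (m <= N)%N by lia.
have /andP[q0 qQ] := V_exponent m0 mN.
have /andP[p0 p1] := p01.
rewrite /expanded /crosses /Vmk /= eN.
rewrite -!/(seg _ _ _) -(opprB 1) seg_upd.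
set i := minn e N.-1.
have iN : (i < N)%N by rewrite /i; lia.
have Ei := E0 _ iN.
have Es j : (k <= j < k + m)%N -> 0 < E j by move=> jk; apply: E0; lia.
case: ifPn => [c|nc]; last first.
  rewrite mul0r addr0.
  rewrite (_ : (k <= i < k + m)%N = false); last by rewrite /i; lia.
  by rewrite mulr0 addr0.
have hi : (k <= i < k + m)%N by rewrite /i; lia.
rewrite hi mulr1 add0r mul1r.
have hS : E i <= seg E m k by exact: le_seg.
apply: (@le_trans _ _ (x `^ (- (1 - a_coef R N m * eta)) * phi01 (1 - eta / 2) p)).
  apply: powR_thinning => //; first exact: ltW.
  have := mulr_gt0 p0 Ei; lra.
rewrite mulrC ler_wpM2l ?addr_ge0 ?powR_ge0//.
have [x1|x1] := leP x 1.
  by rewrite ler_wpDl//; apply: ger_powR; rewrite ?lerN2// x0.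
rewrite ler_wpDr ?powR_ge0// powRN invf_le1 ?powR_gt0//.
apply: (@le_trans _ _ (x `^ 0)); first by rewrite powRr0.
by apply: ler_powR; exact: ltW.
Qed.

End Intervals.

(** * Drift over one step of the uniformized chain *)

Lemma big_nat_ends (T : Type) (x0 : T) (op : Monoid.law x0) (n : nat) (F : nat -> T) :
  (0 < n)%N -> \big[op/x0]_(0 <= i < n.+1) F i =
  op (F 0%N) (op (\big[op/x0]_(0 <= i < n.-1) F i.+1) (F n)).
Proof. by case: n => // n _; rewrite big_nat_recl// big_nat_recr. Qed.

Ltac nat_lia :=
  repeat match goal with
  | H : is_true (Order.le _ _) |- _ => clear H
  | H : is_true (Order.lt _ _) |- _ => clear H
  | H : @eq (Real.sort _) _ _ |- _ => clear H
  end; lia.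

Section Drift.
Variables (R : realType) (N : nat) (TL TR K eta : R).
Implicit Types (E : nat -> R) (I : nat * nat) (f : (nat -> R) -> \bar R).
Hypotheses (N0 : (0 < N)%N) (TL0 : 0 < TL) (TR0 : 0 < TR) (K1 : 1 <= K).
Hypotheses (eta0 : 0 < eta) (etaN : eta * (2 ^ N)%:R < 1).

Local Notation V := (Vfun N eta).
Local Notation VI := (fun E I => Vmk N eta I.1 I.2 E).
Local Notation pos := (positive_config N).

Let pow2N : 2 <= (2 ^ N)%:R :> R.
Proof. by have := two_expn_gt0 R N0; rewrite subr_gt0 ltr1n -(ler_nat R) => /le_trans->. Qed.

Let eta_lt_half : eta < 2^-1.
Proof. by have := ler_wpM2l (ltW eta0) pow2N; have := etaN; lra. Qed.

Let eta_lt1 : eta < 1. Proof. by have := eta_lt_half; lra. Qed.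

(* Clock [e] links sites [e - 1] and [e], counted from 0, so that clocks [0]
   and [N] are the baths. *)
Definition edge_end E (j : nat) : R :=
  if j == 0%N then TL else if j == N.+1 then TR else E j.-1.

Definition clock E (e : nat) : R := rate K (edge_end E e) (edge_end E e.+1).

Definition jump (e : nat) f E : \bar R :=
  if e == 0%N then bath_jump TL f E 0
  else if e == N then bath_jump TR f E N.-1 else inner_jump f E e.-1.

Lemma edge_end_gt0 E j : pos E -> (j <= N.+1)%N -> 0 < edge_end E j.
Proof.
move=> E0 jN; rewrite /edge_end; case: eqP => // j0; case: eqP => // j1.
by apply: E0; nat_lia.
Qed.

Lemma edge_end_site E j : (j < N)%N -> edge_end E j.+1 = E j.
Proof. by move=> jN; rewrite /edge_end/= eqSS (ltn_eqF jN). Qed.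

Lemma clock_itv E e : 0 <= clock E e <= K.
Proof.
rewrite /clock /rate ge_min lexx andbT le_min sqrtr_ge0 andbT.
by apply: le_trans K1.
Qed.

Lemma clock0 E : clock E 0 = rate K TL (E 0%N).
Proof. by rewrite /clock edge_end_site. Qed.

Lemma clockN E : clock E N = rate K (E N.-1) TR.
Proof. by rewrite /clock /edge_end /= eqxx (gtn_eqF N0) (ltn_eqF (ltnSn N)). Qed.

Lemma clock_inner E i : (i.+1 < N)%N -> clock E i.+1 = rate K (E i) (E i.+1).
Proof. by move=> iN; rewrite /clock !edge_end_site// ltnW. Qed.

Lemma sum_clock E : \sum_(0 <= e < N.+1) clock E e = total_rate N TL TR K E.
Proof.
rewrite big_nat_ends// clock0 clockN.
rewrite /=[X in _ + X = _]addrC addrA; congr (_ + _).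
by apply: eq_big_nat => i /andP[_ iN]; rewrite clock_inner//; nat_lia.
Qed.

Lemma Qop_clock f E : Qop N TL TR K f E =
  ((1 - (\sum_(0 <= e < N.+1) clock E e) / lam N K)%:E * f E +
   \sum_(0 <= e < N.+1) (clock E e / lam N K)%:E * jump e f E)%E.
Proof.
rewrite sum_clock /Qop -!addeA; congr (_ + _)%E.
rewrite big_nat_ends//= clock0 clockN.
rewrite /jump /= (gtn_eqF N0) eqxx; congr (_ + _)%E; rewrite addeC; congr (_ + _)%E.
apply: eq_big_nat => i /andP[_ iN]; rewrite clock_inner//; last by nat_lia.
by rewrite ifF//; apply/negbTE; nat_lia.
Qed.

(** Allowing any [f] below [V + a] covers the iterates of [Qop] on [V]. Uncrossed terms pass through
    unchanged; [C] bounds the moments of the fraction and of the bath energy, uniformly in [E]. *)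
Lemma jump_bound : exists2 C, 0 <= C & forall E f a e, pos E -> 0 <= a ->
  (forall F, pos F -> (0 <= f F <= (V F + a)%:E)%E) -> (e <= N)%N ->
  (0 <= jump e f E <= (a + \sum_(I <- ivs N)
     (if crosses e I then C * expanded N eta E e I else VI E I))%:E)%E.
Proof.
have Q0 : 0 < 1 - eta / 2 by have := eta_lt1; lra.
have Q1 : 1 - eta / 2 < 1 by have := eta0; lra.
have [CL CL0 HL] := bath_jump_affine_bound TL0 Q0 Q1.
have [CR CR0 HR] := bath_jump_affine_bound TR0 Q0 Q1.
pose CI := 2 / (1 - (1 - eta / 2)).
have CI0 : 0 <= CI by rewrite divr_ge0// ltW// subr_gt0.
have [CC [CLC CRC CIC]] : exists CC, [/\ CL <= CC, CR <= CC & CI <= CC].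
  by exists (CL + CR + CI); split; lra.
exists CC => [|E f a e E0 a0 Hf eN]; first exact: le_trans CIC.
pose b := a + \sum_(I <- ivs N) (if crosses e I then 0 else VI E I).
pose c := \sum_(I <- ivs N) (if crosses e I then expanded N eta E e I else 0).
have b0 : 0 <= b.
  rewrite addr_ge0// big_seq sumr_ge0// => I Ir; case: ifP => // _.
  by rewrite ltW ?Vmk_gt0.
have c0 : 0 <= c.
  rewrite sumr_ge0// => I _; case: ifP => // _.
  by rewrite /expanded; case: ifP => // _; exact: powR_ge0.
have -> : a + \sum_(I <- ivs N) (if crosses e I
    then CC * expanded N eta E e I else VI E I) =
    b + c * CC.
  rewrite /b /c -addrA mulr_suml -big_split/=; congr (_ + _).
  by apply: eq_bigr => I _; case: ifP => _; [rewrite add0r mulrC|rewrite mul0r addr0].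
have bc x g : 0 <= g -> (x <= (b + c * g)%:E)%E ->
    g <= CC -> (x <= (b + c * CC)%:E)%E.
  move=> g0 xg gC; apply: (le_trans xg).
  by rewrite lee_fin lerD2l ler_wpM2l.
have VF F w : 0 <= w -> (forall I, I \in ivs N -> VI F I <=
      (if crosses e I then 0 else VI E I) +
      (if crosses e I then expanded N eta E e I else 0) * w) ->
    V F + a <= b + c * w.
  move=> w0 H; rewrite addrC /b /c -addrA lerD2l mulr_suml -big_split/=.
  by rewrite Vfun_ivs big_seq [leRHS]big_seq; apply: ler_sum.
have phi0 p : 0 <= phi01 (1 - eta / 2) p by rewrite addr_ge0 ?powR_ge0.
have bath (isb : (e == 0%N) || (e == N)) p x : 0 < p < 1 -> 0 < x ->
    (0 <= f (upd E (minn e N.-1) (p * (E (minn e N.-1) + x))) <=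
    (b + c * (phi01 (1 - eta / 2) p * (1 + x `^ (- (1 - eta / 2)))))%:E)%E.
  move=> p01 x0.
  have posF : pos (upd E (minn e N.-1) (p * (E (minn e N.-1) + x))).
    apply: positive_upd => //; have /andP[p0 _] := p01.
    by rewrite mulr_gt0// addr_gt0//; apply/E0/(leq_ltn_trans (geq_minr _ _)); rewrite ltn_predL.
  have /andP[-> h] := Hf _ posF; apply: (le_trans h); rewrite lee_fin.
  apply: VF => [|I Ir]; first by rewrite mulr_ge0// addr_ge0// powR_ge0.
  exact: Vmk_bath_le.
rewrite /jump; case: eqP => [e0|/eqP e0].
  have /andP[-> h] : (0 <= bath_jump TL f E 0 <= (b + c * CL)%:E)%E.
    apply: HL => // p x p01 x0.
    by have := bath _ p x p01 x0; rewrite e0 min0n; exact.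
  exact: (bc _ CL).
case: eqP => [eN'|/eqP eN'].
  have /andP[-> h] : (0 <= bath_jump TR f E N.-1 <= (b + c * CR)%:E)%E.
    apply: HR => // p x p01 x0.
    have := bath _ p x p01 x0; rewrite eN' eqxx orbT.
    by rewrite (minn_idPr (leq_pred N)); exact.
  exact: (bc _ CR).
have /andP[-> h] : (0 <= inner_jump f E e.-1 <= (b + c * CI)%:E)%E.
  apply: (inner_jump_affine_bound Q0 Q1) => // p p01.
  have posF : pos (exch E e.-1 p).
    by apply: positive_exch => //; rewrite prednK ?lt0n// ltn_neqAle eN'.
  have /andP[-> h] := Hf _ posF; apply: (le_trans h); rewrite lee_fin.
  apply: VF => // I Ir; apply: Vmk_exch_le => //.
  by rewrite lt0n e0 ltn_neqAle eN'.
exact: (bc _ CI).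
Qed.

(** The total [D] removed: a ring at the boundary of [I] counts as a loss of its whole term, the new
    value being counted as a gain. *)
Definition dissipation E : R :=
  \sum_(0 <= e < N.+1) \sum_(I <- ivs N | crosses e I) clock E e * VI E I.

Lemma dissipation_ge0 E : pos E -> 0 <= dissipation E.
Proof.
move=> E0; rewrite sumr_ge0// => e _; rewrite big_seq_cond sumr_ge0// => I /andP[? _].
by have /andP[? _] := clock_itv E e; rewrite mulr_ge0// ltW// Vmk_gt0.
Qed.

Lemma dissipation_ge E e I : pos E -> (e <= N)%N -> I \in ivs N -> crosses e I ->
  clock E e * VI E I <= dissipation E.
Proof.
move=> E0 eN Ir eI.
have H e' I' : I' \in ivs N -> 0 <= clock E e' * VI E I'.
  by move=> ?; have /andP[? _] := clock_itv E e'; rewrite mulr_ge0// ltW// Vmk_gt0.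
have S0 e' (r : seq (nat * nat)) : {subset r <= ivs N} ->
    0 <= \sum_(I <- r | crosses e' I) clock E e' * VI E I.
  by move=> rs; rewrite big_seq_cond sumr_ge0// => I' /andP[/rs ? _]; exact: H.
rewrite /dissipation (big_rem e) /=; last by rewrite mem_index_iota.
rewrite ler_wpDr//; first by rewrite sumr_ge0// => e' _; exact: S0.
by rewrite (big_rem I)//= eI ler_wpDr// S0// => J /mem_rem.
Qed.

Let al := 1 - (2 * (1 - eta))^-1.

Let al01 : 0 < al < 1.
Proof.
have e1 := eta_lt_half; have e0 := eta0.
have h : (2 * (1 - eta))^-1 < 1 by rewrite invf_lt1; lra.
have h' : 0 < (2 * (1 - eta))^-1 by rewrite invr_gt0; lra.
by rewrite /al; apply/andP; split; lra.
Qed.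

Lemma dissipation_ge_power : exists2 C, 0 <= C & forall E I, pos E -> I \in ivs N ->
  VI E I `^ al <= dissipation E + C.
Proof.
(* For energies up to 1 the cap [K] is inactive; up to [TR] the right bath cannot be strictly the
   smaller end. Above [d] the power is at most [d^-1]. *)
pose d := Num.min 1 TR.
have d0 : 0 < d by rewrite lt_min ltr01.
exists d^-1 => [|E [m k] E0]; first by rewrite invr_ge0 ltW.
move=> Ir; move: (Ir); rewrite mem_ivs => /andP[m0 kN] /=.
have mN : (m <= N)%N by nat_lia.
have /andP[q0 qQ] := V_exponent eta0 eta_lt1 m0 mN.
have /andP[al0 al1] := al01.
have s0 : 0 < seg E m k by apply: seg_gt0 => // j jk; apply: E0; nat_lia.
have D0 := dissipation_ge0 E0.
have VE : Vmk N eta m k E = seg E m k `^ (- (1 - a_coef R N m * eta)).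
  by rewrite /Vmk opprB.
have [sd|ds] := leP (seg E m k) d; last first.
  rewrite ler_wpDl// VE -powRrM mulNr powRN lef_pV2 ?posrE ?powR_gt0//.
  set r := _ * al.
  have r0 : 0 <= r by rewrite mulr_ge0 ?ltW.
  have r1 : r <= 1.
    have : r <= 1 * 1; last by rewrite mulr1.
    by apply: ler_pM; rewrite ?ltW//; have := eta0; lra.
  apply: (@le_trans _ _ (d `^ r)).
    by apply: ger1_powR => //; rewrite d0 ge_min lexx.
  by apply: ge0_ler_powR; rewrite ?nnegrE// ltW.
rewrite ler_wpDr ?invr_ge0 ?(ltW d0)//.
set e := (k + m)%N.
have e0 : (0 < e)%N by rewrite /e; nat_lia.
pose x := E e.-1; pose y := edge_end E e.+1; pose u := Num.min x y.
have xE : edge_end E e = x.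
  by rewrite /edge_end/x (gtn_eqF e0) ifF//; apply/negbTE; rewrite /e; nat_lia.
have x0 : 0 < x by apply: E0; rewrite /e; nat_lia.
have y0 : 0 < y by apply: edge_end_gt0.
have u0 : 0 < u by rewrite lt_min x0.
have xs : x <= seg E m k.
  by apply: le_seg => [j jk|]; [apply: E0|]; rewrite /e; nat_lia.
have clockE : clock E e = Num.sqrt u.
  rewrite /clock xE -/y -/u /rate; apply/min_idPr; apply: le_trans K1.
  rewrite -(sqrtr1 R) ler_wsqrtr//.
  rewrite /u ge_min (le_trans xs)// (le_trans sd)// /d ge_min lexx //.
rewrite VE; apply: (@powR_geometric_mean _ eta al _ _ u) => //.
  rewrite -clockE -VE; apply: (@dissipation_ge E e (m, k)) => //.
  by rewrite /crosses/= eqxx orbT.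
have single j : (j < N)%N -> Vmk N eta 1 j E = E j `^ (eta - 1).
  by move=> jN; rewrite /Vmk a_coef1 mul1r big_nat1 addn0.
(* Edge [e] bounds the single site of energy [u], on whichever side it lies, so that site supplies
   the second bound of the geometric mean. *)
rewrite -clockE; have [xy|yx] := leP x y.
  have -> : u = x by apply/min_idPl.
  rewrite /x -single; last by rewrite /e; nat_lia.
  apply: (@dissipation_ge E e (1%N, e.-1)) => //.
    by rewrite mem_ivs/= /e; nat_lia.
  by rewrite /crosses /=; apply/orP; right; apply/eqP; rewrite /e; nat_lia.
have -> : u = y by apply/min_idPr; exact: ltW.
(* At [e = N] the end [y] would be [TR], at least [d] and hence at least [x], against [y < x]. *)
have eN : (e < N)%N.
  rewrite ltnNge; apply/negP => Ne.
  have eN : e = N by rewrite /e in Ne *; nat_lia.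
  move: yx; rewrite ltNge => /negP; apply.
  rewrite /y /edge_end eN /= eqxx (le_trans xs)// (le_trans sd)//.
  by rewrite /d ge_min lexx orbT.
rewrite /y edge_end_site// -single//.
apply: (@dissipation_ge E e (1%N, e)) => //; first by rewrite mem_ivs/=; nat_lia.
by rewrite /crosses /= eqxx.
Qed.

Lemma gain_absorbed (c C : R) : 0 < c -> 0 <= C ->
  exists2 B, 0 <= B & forall E e I, pos E -> (e <= N)%N -> I \in ivs N ->
  crosses e I -> clock E e * (C * expanded N eta E e I) <= c * dissipation E + B.
Proof.
move=> c0 C0; have [CD CD0 HD] := dissipation_ge_power.
have /andP[al0 al1] := al01.
have K0 : 0 <= K by apply: le_trans K1.
have C1 : 0 < C + 1 by rewrite ltr_wpDl.
(* The added 1 keeps [c1] positive even if [C = 0], with [C * c1 <= c]. *)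
pose c1 := c / (C + 1).
have c10 : 0 < c1 by rewrite divr_gt0.
have Cc1 : C * c1 <= c.
  rewrite /c1 mulrA ler_pdivrMr// mulrC ler_wpM2l ?(ltW c0)//; lra.
(* The absorption constant depends on the length [m]. The condition is vacuous unless 0 < m < N, so
   a constant can be chosen for every [m]; their sum [B] is uniform. *)
pose absorbed m b := 0 <= b /\ ((0 < m)%N -> (m < N)%N ->
    forall s g : R, 0 < s -> 0 <= g -> g <= K -> g <= Num.sqrt s ->
      g * s `^ (- (1 - a_coef R N m * eta)) <=
      c1 * s `^ (- ((1 - a_coef R N m.+1 * eta) * al)) + b).
have /boolp.choice[Bm HB] : forall m, exists b : R, absorbed m b.
  move=> m; rewrite /absorbed.
  have [/andP[m0 mN]|nm] := boolP ((0 < m)%N && (m < N)%N); last first.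
    by exists 0; split=> // m0 mN; rewrite m0 mN in nm.
  have /andP[q0 qQ] := V_exponent eta0 eta_lt1 m0 (ltnW mN).
  have h : 1 - a_coef R N m * eta < (1 - a_coef R N m.+1 * eta) * al + 2^-1.
    apply: (@powR_Nexp_le _ eta al _ _ (a_coef R N m) (a_coef R N m.+1)) => //.
    (* Multiplied by 2^N - 1, the required margin becomes 1 - eta 2^m, positive by [etaN]. *)
    have [g1 g2] := a_coef_gap R m0 mN.
    rewrite -(pmulr_lgt0 _ (two_expn_gt0 R N0)) mulrBl g1.
    have : (2 ^ m)%:R <= (2 ^ N)%:R :> R by rewrite ler_nat leq_exp2l// ltnW.
    move=> /(ler_wpM2l (ltW eta0)) h; have := etaN.
    have -> : 2 * (a_coef R N m - a_coef R N m.+1) * eta * ((2 ^ N)%:R - 1) =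
      eta * (2 * ((a_coef R N m - a_coef R N m.+1) * ((2 ^ N)%:R - 1))) by ring.
    by rewrite g2; move: h; lra.
  have [B B0 HB] := powR_absorb c10 K0 (ltW q0) h.
  by exists B.
have Bm0 m : 0 <= Bm m by have [] := HB m.
pose B := \sum_(0 <= m < N) Bm m.
have B0 : 0 <= B by rewrite sumr_ge0.
have BmB m : (m < N)%N -> Bm m <= B.
  by move=> mN; rewrite /B (big_rem m) ?mem_index_iota//= ler_wpDr ?sumr_ge0.
exists (K * C + c * CD + C * B); first by rewrite !addr_ge0 ?mulr_ge0// ltW.
move=> E e [m k] E0 eN Ir eI.
have D0 := dissipation_ge0 E0.
have /andP[g0 gK] := clock_itv E e.
have KC : 0 <= K * C by rewrite mulr_ge0.
have cCD : 0 <= c * CD by rewrite mulr_ge0// ltW.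
have cD : 0 <= c * dissipation E by rewrite mulr_ge0// ltW.
have CB : 0 <= C * B by rewrite mulr_ge0.
rewrite /expanded; case: ifPn => [_|].
  have := ler_wpM2r C0 gK; rewrite mulr1; lra.
(* [k'] is the left end of [J]; since [e] is not a bath edge, [J] still fits in the [N] sites. *)
rewrite negb_or => /andP[e0 eN'] /=; set k' := if _ then _ else _.
move: Ir eI; rewrite mem_ivs /crosses /= => /andP[m0 kN] eI.
have [mN Jr] : (m < N)%N /\ (m.+1, k') \in ivs N.
  by rewrite mem_ivs /k'; case: ifP eI => /= h eI; split; nat_lia.
have ek : (k' <= e < k' + m.+1)%N.
  by rewrite /k'; case: ifP eI => /= h eI; nat_lia.
have Es j : (k' <= j < k' + m.+1)%N -> 0 < E j.
  by move: Jr; rewrite mem_ivs => ? ?; apply: E0; nat_lia.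
have s0 : 0 < seg E m.+1 k' by apply: seg_gt0.
(* Site [e] belongs to [J], so the rate is at most the square root of S_J. *)
have gs : clock E e <= Num.sqrt (seg E m.+1 k').
  rewrite /clock /rate ge_min; apply/orP; right; rewrite ler_wsqrtr// ge_min.
  apply/orP; right; rewrite edge_end_site; last by nat_lia.
  exact: le_seg.
have [_ /(_ m0 mN _ _ s0 g0 gK gs) h] := HB m.
rewrite mulrCA -(opprB 1).
apply: (le_trans (ler_wpM2l C0 h)).
have := HD E _ E0 Jr; rewrite /= /Vmk -/(seg _ _ _) -(opprB 1) -powRrM mulNr => h2.
have h3 := ler_wpM2l (ltW c10) h2.
have h4 := ler_wpM2l C0 h3.
have h5 := ler_wpM2l C0 (BmB _ mN).
have h6 : C * c1 * (dissipation E + CD) <= c * (dissipation E + CD).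
  by rewrite ler_wpM2r// addr_ge0.
rewrite mulrDr mulrA; move: h4 h6; rewrite !mulrA; lra.
Qed.

Lemma total_rate_le_lam E : (\sum_(0 <= e < N.+1) clock E e) / lam N K <= 1.
Proof.
have l0 : 0 < lam N K by rewrite mulr_gt0// (lt_le_trans _ K1).
rewrite ler_pdivrMr// mul1r /lam mulr_natl.
apply: (@le_trans _ _ (\sum_(0 <= e < N.+1) K)).
  by apply: ler_sum => e _; have /andP[] := clock_itv E e.
by rewrite sumr_const_nat subn0.
Qed.

Lemma drift : exists c C, [/\ 0 < c, 0 <= C & forall E f a, pos E -> 0 <= a ->
  (forall F, pos F -> (0 <= f F <= (V F + a)%:E)%E) ->
  (0 <= Qop N TL TR K f E <= (V E - c * V E `^ al + C + a)%:E)%E].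
Proof.
have [CJ CJ0 HJ] := jump_bound.
have [CD CD0 HD] := dissipation_ge_power.
have /andP[al0 al1] := al01.
have l0 : 0 < lam N K by rewrite mulr_gt0// (lt_le_trans _ K1).
pose n1 : R := (size (ivs N))%:R.
pose n : R := N.+1%:R * n1.
have n10 : 0 < n1.
  rewrite ltr0n; have : (1%N, 0%N) \in ivs N by rewrite mem_ivs; nat_lia.
  by case: (ivs N).
have n0 : 0 < n by rewrite mulr_gt0.
have e0 : 0 < (2 * n)^-1 by rewrite invr_gt0 mulr_gt0.
(* There are at most [n] crossing pairs of an edge and an interval; at a share [(2 * n)^-1] of [D]
   each, all gains together cost half of [D], up to constants. *)
have [B B0 HB] := gain_absorbed e0 CJ0.
(* The other half of [D] yields the power, since V^al <= n1 (D + CD) by subadditivity. *)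
exists ((2 * n1 * lam N K)^-1), ((n * B + CD / 2) / lam N K); split.
- by rewrite invr_gt0; apply: mulr_gt0 => //; apply: mulr_gt0.
- apply: divr_ge0; last exact: ltW.
  by apply: addr_ge0; [apply: mulr_ge0 => //; exact: ltW|apply: divr_ge0].
move=> E f a E0 a0 Hf.
have g0 e : 0 <= clock E e / lam N K.
  by have /andP[? _] := clock_itv E e; rewrite divr_ge0// ltW.
have S1 := total_rate_le_lam E.
have /andP[f0 fV] := Hf _ E0.
rewrite Qop_clock; apply/andP; split.
  apply: adde_ge0; first by rewrite mule_ge0// lee_fin subr_ge0.
  rewrite big_nat; apply: sume_ge0 => e eN; rewrite mule_ge0 ?lee_fin//.
  by have /andP[] := HJ E f a e E0 a0 Hf eN.
pose U e := \sum_(I <- ivs N) (if crosses e I then CJ * expanded N eta E e I else VI E I).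
apply: (@le_trans _ _ ((1 - (\sum_(0 <= e < N.+1) clock E e) / lam N K) * (V E + a) +
   \sum_(0 <= e < N.+1) (clock E e / lam N K * (a + U e)))%:E).
  rewrite [leRHS]EFinD -sumEFin leeD//.
    by rewrite [leRHS]EFinM lee_wpmul2l// lee_fin subr_ge0.
  rewrite big_nat [leRHS]big_nat; apply: lee_sum => e eN.
  rewrite [leRHS]EFinM lee_wpmul2l ?lee_fin//.
  by have /andP[] := HJ E f a e E0 a0 Hf eN.
rewrite lee_fin.
have UV e : U e - V E = \sum_(I <- ivs N | crosses e I) (CJ * expanded N eta E e I - VI E I).
  rewrite /U Vfun_ivs -sumrB [RHS]big_mkcond/=.
  by apply: eq_bigr => I _; case: ifP => // _; rewrite subrr.
pose G := \sum_(0 <= e < N.+1) \sum_(I <- ivs N | crosses e I)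
   clock E e * (CJ * expanded N eta E e I).
(* Holding and uncrossed terms recombine to [V E + a], leaving gain minus loss over the
   uniformization rate. *)
have -> : (1 - (\sum_(0 <= e < N.+1) clock E e) / lam N K) * (V E + a) +
   \sum_(0 <= e < N.+1) (clock E e / lam N K * (a + U e)) =
   V E + a + (G - dissipation E) / lam N K.
  rewrite /G /dissipation -sumrB !mulr_suml mulrBl mul1r -addrA; congr (_ + _).
  rewrite mulr_suml -sumrN -big_split/=; apply: eq_bigr => e _.
  rewrite -sumrB -[U e](subrK (V E)) UV.
  have -> : \sum_(I <- ivs N | crosses e I) (clock E e * (CJ * expanded N eta E e I) -
     clock E e * VI E I) = clock E e *
     \sum_(I <- ivs N | crosses e I) (CJ * expanded N eta E e I - VI E I).
    by rewrite mulr_sumr; apply: eq_bigr => I _; rewrite mulrBr.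
  ring.
have D0 := dissipation_ge0 E0.
have GD : G <= n * ((2 * n)^-1 * dissipation E + B).
  set M := (2 * n)^-1 * dissipation E + B.
  have M0 : 0 <= M by rewrite addr_ge0// mulr_ge0// ltW.
  have -> : n * M = \sum_(0 <= e < N.+1) \sum_(I <- ivs N) M.
    by rewrite sumr_const_nat subn0 big_const_seq count_predT iter_addr_0 /n /n1 -mulrA !mulr_natl.
  rewrite /G big_nat [leRHS]big_nat; apply: ler_sum => e eN.
  rewrite big_mkcond/= big_seq [leRHS]big_seq; apply: ler_sum => I Ir.
  by case: ifP => // eI; exact: HB.
have VD : V E `^ al <= n1 * (dissipation E + CD).
  rewrite Vfun_ivs; apply: (le_trans (powR_le_sum al0 (ltW al1) _)).
    by move=> I Ir; exact: Vmk_gt0.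
  have -> : n1 * (dissipation E + CD) = \sum_(I <- ivs N) (dissipation E + CD).
    by rewrite big_const_seq count_predT iter_addr_0 /n1 mulr_natl.
  by rewrite big_seq [leRHS]big_seq; apply: ler_sum => I Ir; exact: HD.
have -> : V E - (2 * n1 * lam N K)^-1 * V E `^ al + (n * B + CD / 2) / lam N K + a =
  V E + a + (n * B + CD / 2 - (2 * n1)^-1 * V E `^ al) / lam N K.
  by field; rewrite !gt_eqF.
rewrite lerD2l ler_pM2r ?invr_gt0//.
have h1 : (2 * n1)^-1 * V E `^ al <= (dissipation E + CD) / 2.
  rewrite mulrC ler_pdivrMr ?mulr_gt0//; apply: (le_trans VD).
  by rewrite [leRHS](_ : _ = n1 * (dissipation E + CD))//; field.
have h2 : n * ((2 * n)^-1 * dissipation E + B) = dissipation E / 2 + n * B.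
  by field; rewrite gt_eqF.
by rewrite h2 in GD; lra.
Qed.

End Drift.

(** * Averaging over the Poisson number of steps *)

Section Poisson.
Variable R : realType.
Implicit Types x : R.

Definition poisson_weight x n : R := expR (- x) * x ^+ n / n`!%:R.

Lemma poisson_weight_ge0 x n : 0 <= x -> 0 <= poisson_weight x n.
Proof. by move=> x0; rewrite divr_ge0// mulr_ge0 ?expR_ge0// exprn_ge0. Qed.

Lemma sum_poisson_weight_le1 x M : 0 <= x -> \sum_(0 <= n < M) poisson_weight x n <= 1.
Proof.
move=> x0; rewrite /poisson_weight.
under eq_bigr do rewrite -mulrA.
rewrite -mulr_sumr expRN mulrC ler_pdivrMr ?expR_gt0// mul1r.
apply: (nondecreasing_cvgn_le _ (is_cvg_series_exp_coeff x)).
apply/nondecreasing_seqP => n; rewrite /series/= big_nat_recr//= lerDl.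
exact: exp_coeff_ge0.
Qed.

Lemma poisson_weightS x n :
  poisson_weight x n.+1 * n.+1%:R = x * poisson_weight x n.
Proof.
rewrite /poisson_weight exprS factS natrM; field.
by rewrite nat1r !pnatr_eq0 -lt0n fact_gt0.
Qed.

(** Zero steps have weight [expR (- x)], and the other weights sum to at most the complement. The
    growth [n%:R * C] is averaged through n <= n + 1 and [poisson_weightS], which bounds the mean by
    [x]. *)
Lemma poisson_series_le x (u : nat -> \bar R) (V U C : R) :
  0 <= x -> 0 <= C -> 0 <= U -> 0 <= V -> (forall n, 0 <= u n)%E ->
  (u 0%N <= V%:E)%E -> (forall n, u n.+1 <= (U + n%:R * C)%:E)%E ->
  (\sum_(0 <= n <oo) (poisson_weight x n)%:E * u n <=
   (expR (- x) * V + (1 - expR (- x)) * U + x * C)%:E)%E.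
Proof.
move=> x0 C0 U0 V0 u0 uV uU.
have w0 n : 0 <= poisson_weight x n by exact: poisson_weight_ge0.
have wE : poisson_weight x 0 = expR (- x) by rewrite /poisson_weight expr0 fact0 mulr1 divr1.
have e1 : expR (- x) <= 1 by rewrite -(expR0 R) ler_expR oppr_le0.
apply: lime_le.
  by apply: is_cvg_nneseries => n _ _; rewrite mule_ge0// lee_fin.
apply: nearW => -[|M].
  rewrite big_geq// lee_fin !addr_ge0 ?mulr_ge0 ?expR_ge0 ?subr_ge0//.
rewrite big_nat_recl// wE -addrA EFinD leeD//.
  by rewrite EFinM lee_wpmul2l// lee_fin expR_ge0.
apply: (@le_trans _ _ (\sum_(0 <= n < M) poisson_weight x n.+1 * (U + n%:R * C))%:E).
  rewrite -sumEFin; apply: lee_sum => n _.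
  by rewrite [leRHS]EFinM lee_wpmul2l// lee_fin.
rewrite lee_fin; under eq_bigr do rewrite mulrDr.
rewrite big_split/= -mulr_suml lerD//.
  rewrite ler_wpM2r// lerBrDl -wE.
  by have := sum_poisson_weight_le1 M.+1 x0; rewrite big_nat_recl.
apply: (@le_trans _ _ (\sum_(0 <= n < M) x * poisson_weight x n * C)).
  apply: ler_sum => n _; rewrite mulrA ler_wpM2r// -poisson_weightS.
  by rewrite ler_wpM2l// ler_nat.
rewrite -mulr_suml ler_wpM2r// -mulr_sumr.
by have := ler_wpM2l x0 (sum_poisson_weight_le1 M x0); rewrite mulr1.
Qed.

End Poisson.

(** The outermost [Qop] is the first step from [E] and keeps the negative term; for all later steps
    that term is dropped, leaving growth [C] each. *)
Lemma iter_Qop_bound (R : realType) (N : nat) (TL TR K eta c C al : R) :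
  0 <= c -> 0 <= C ->
  (forall (E : nat -> R) f a, positive_config N E -> 0 <= a ->
    (forall F, positive_config N F -> (0 <= f F <= (Vfun N eta F + a)%:E)%E) ->
    (0 <= Qop N TL TR K f E <=
      (Vfun N eta E - c * Vfun N eta E `^ al + C + a)%:E)%E) ->
  forall n (E : nat -> R), positive_config N E ->
   (0 <= iter n.+1 (Qop N TL TR K) (fun F => (Vfun N eta F)%:E) E <=
     (Vfun N eta E - c * Vfun N eta E `^ al + C + n%:R * C)%:E)%E.
Proof.
move=> c0 C0 H; elim=> [|n IH] E E0.
  apply: H => // [|F F0]; first by rewrite mul0r.
  by rewrite mul0r addr0 lexx lee_fin Vfun_ge0.
rewrite iterS; apply: H => // [|F F0]; first by rewrite mulr_ge0.
have /andP[-> h] := IH F F0; apply: (le_trans h); rewrite lee_fin -natr1.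
have := mulr_ge0 c0 (powR_ge0 (Vfun N eta F) al); lra.
Qed.

Theorem theorem4p1 (R : realType) (N : nat) (TL TR : R) :
  (1 <= N)%N -> 0 < TL -> 0 < TR ->
  exists K0 : R, forall K : R, K0 <= K ->
  exists eta0 : R, 0 < eta0 /\
  exists h0 : R, 0 < h0 /\
  forall eta h : R, 0 < eta -> eta < eta0 -> 0 < h -> h < h0 ->
  exists c0 M0 : R, 0 < c0 /\ 1 < M0 /\
  forall E : nat -> R, (forall i, (i < N)%N -> 0 < E i) ->
    M0 < Vfun N eta E ->
    (Pt N TL TR K h (fun F => (Vfun N eta F)%:E) E
     <= (Vfun N eta E - c0 * Vfun N eta E `^ (1 - (2 * (1 - eta))^-1))%:E)%E.
Proof.
move=> N0 TL0 TR0; exists 1 => K K1.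
have pow0 : 0 < (2 ^ N)%:R :> R by rewrite ltr0n expn_gt0.
(* This smallness of [eta] keeps every exponent gap positive. *)
exists ((2 ^ N)%:R^-1); split; first by rewrite invr_gt0.
exists 1; split => // eta h eta0 etaN h0 _.
have {}etaN : eta * (2 ^ N)%:R < 1 by rewrite -ltr_pdivlMr// div1r.
have [c [C [c0 C0 H]]] := drift N0 TL0 TR0 K1 eta0 etaN.
set al := 1 - (2 * (1 - eta))^-1 in H *.
have al0 : 0 < al.
  have p2 : 2 <= (2 ^ N)%:R :> R by rewrite ler_nat -{1}(expn1 2) leq_exp2l.
  have e2 := ler_wpM2l (ltW eta0) p2.
  by rewrite /al subr_gt0 invf_lt1; lra.
set x := lam N K * h.
have x0 : 0 < x by rewrite !mulr_gt0// (lt_le_trans _ K1).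
have w1 : expR (- x) < 1 by rewrite expR_lt1 oppr_lt0.
have w1' : 0 < 1 - expR (- x) by rewrite subr_gt0.
(* Half of the averaged decrease is kept; the other half absorbs the constants once V^al reaches
   [B]. *)
pose c1 := (1 - expR (- x)) * c / 2.
have c10 : 0 < c1 by rewrite divr_gt0// mulr_gt0.
pose B := ((1 - expR (- x)) * C + x * C) / c1.
have B0 : 0 <= B.
  by apply: divr_ge0; [apply: addr_ge0; apply: mulr_ge0 => //|]; exact: ltW.
(* The power of [B] forces V^al >= B, and the 2 makes the threshold exceed 1. *)
exists c1, (2 + B `^ al^-1); split=> //; split.
  by have := powR_ge0 B al^-1; lra.
move=> E E0 VM.
have VB : B <= Vfun N eta E `^ al.
  have -> : B = (B `^ al^-1) `^ al by rewrite -powRrM mulVf ?gt_eqF// powRr1.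
  have := powR_ge0 B al^-1 => ?.
  by apply: ge0_ler_powR; rewrite ?nnegrE// ?ltW//; lra.
have W := iter_Qop_bound (ltW c0) C0 H.
have V0 : 0 <= Vfun N eta E by apply: Vfun_ge0.
have U0 : 0 <= Vfun N eta E - c * Vfun N eta E `^ al + C.
  have /andP[h1 h2] := W 0%N E E0; have := le_trans h1 h2.
  by rewrite lee_fin mul0r addr0.
apply: (le_trans (poisson_series_le (ltW x0) C0 U0 V0 _ _ _)).
- by case=> [|n]; [rewrite lee_fin|have /andP[] := W n E E0].
- by [].
- by move=> n; have /andP[] := W n E E0.
have Bc : B * c1 = (1 - expR (- x)) * C + x * C by rewrite /B divfK ?gt_eqF.
have := ler_wpM2r (ltW c10) VB; rewrite Bc lee_fin /c1; lra.
Qed.
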